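(* Let $(X,d)$ and $(Y,\rho)$ be quasi-metric spaces, where $(X,d)$ is $T_1$ and has the property that forward convergence implies backward convergence. If $f:(X,d)\to(Y,\rho)$ is a left K-Cauchy regular map, then $f$ is ff-continuous.
   Context: A quasi-metric on a set $X$ is a function $d:X\times X\to\mathbb{R}$ such that for all $x,y,z\in X$: $d(x,y)\ge 0$ and $d(x,x)=0$; $d(x,y)=0=d(y,x)$ implies $x=y$; and $d(x,y)\le d(x,z)+d(z,y)$ (symmetry is not required). Put $B^+(x,\epsilon)=\{y\in X:d(x,y)<\epsilon\}$; the forward topology $\tau(d)$ is the topology generated by these balls. $(X,d)$ is $T_1$ if $\tau(d)$ is $T_1$ (equivalently, $d(x,y)>0$ whenever $x\ne y$). A sequence $(x_n)$ is forward convergent to $x$ if $\lim_n d(x,x_n)=0$, and backward convergent to $x$ if $\lim_n d(x_n,x)=0$. The property ''forward convergence implies backward convergence'' means: whenever $(x_n)$ is forward convergent to $x$, it is backward convergent to $x$. A sequence $(x_n)$ is left K-Cauchy if for every $\epsilon>0$ there is $n_0\in\mathbb{N}$ such that $d(x_k,x_n)<\epsilon$ whenever $n_0\le k\le n$. A map $f:(X,d)\to(Y,\rho)$ is left K-Cauchy regular if it maps every left K-Cauchy sequence in $(X,d)$ to a left K-Cauchy sequence in $(Y,\rho)$. It is ff-continuous if for every $x\in X$ and $\epsilon>0$ there is $\delta>0$ such that $d(x,y)<\delta$ implies $\rho(f(x),f(y))<\epsilon$. *)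

(* Defs.v *)
From HB Require Import structures.
From mathcomp Require Import all_boot all_order all_algebra.
From mathcomp Require Import boolp classical_sets reals topology normedtype.
Import Order.TTheory GRing.Theory Num.Theory.
Import numFieldNormedType.Exports.

Set Implicit Arguments.
Unset Strict Implicit.
Unset Printing Implicit Defensive.

Local Open Scope classical_set_scope.
Local Open Scope ring_scope.

Record is_quasimetric (R : realType) (X : Type) (d : X -> X -> R) : Prop :=
  IsQuasimetric {
    qm_ge0 : forall x y, 0 <= d x y;
    qm_refl : forall x, d x x = 0;
    qm_sep : forall x y, d x y = 0 -> d y x = 0 -> x = y;
    qm_triangle : forall x y z, d x y <= d x z + d z y }.

Definition forward_ball (R : realType) (X : Type) (d : X -> X -> R)
  (x : X) (e : R) : set X := [set y | d x y < e].

(* A copy of X indexed by d, so that the topology tau(d) can be attached to it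
   canonically. *)
Definition forward_space (R : realType) (X : Type) (d : X -> X -> R) : Type :=
  X.

HB.instance Definition _ (R : realType) (X : Type) (d : X -> X -> R) :=
  Choice.copy (forward_space d) {classic X}.

(* tau(d) is generated by the balls as a subbase, which makes sense for any d;
   for a quasi-metric the balls even form a base. *)
HB.instance Definition _ (R : realType) (X : Type) (d : X -> X -> R) :=
  isSubBaseTopological.Build (forward_space d)
    [set B : set (forward_space d) | exists x (e : R),
       0 < e /\ B = forward_ball d x e] id.

Definition forward_T1 (R : realType) (X : Type) (d : X -> X -> R) : Prop :=
  accessible_space (forward_space d).

Definition forward_cvg (R : realType) (X : Type) (d : X -> X -> R)
  (u : nat -> X) (x : X) : Prop := d x (u n) @[n --> \oo] --> (0 : R).

Definition backward_cvg (R : realType) (X : Type) (d : X -> X -> R)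
  (u : nat -> X) (x : X) : Prop := d (u n) x @[n --> \oo] --> (0 : R).

Definition forward_implies_backward (R : realType) (X : Type)
  (d : X -> X -> R) : Prop :=
  forall (u : nat -> X) (x : X), forward_cvg d u x -> backward_cvg d u x.

Definition left_K_cauchy (R : realType) (X : Type) (d : X -> X -> R)
  (u : nat -> X) : Prop :=
  forall e : R, 0 < e -> exists n0 : nat, forall k n : nat,
    (n0 <= k)%N -> (k <= n)%N -> d (u k) (u n) < e.

Definition left_K_cauchy_regular (R : realType) (X Y : Type)
  (d : X -> X -> R) (rho : Y -> Y -> R) (f : X -> Y) : Prop :=
  forall u : nat -> X, left_K_cauchy d u -> left_K_cauchy rho (f \o u).

Definition ff_continuous (R : realType) (X Y : Type)
  (d : X -> X -> R) (rho : Y -> Y -> R) (f : X -> Y) : Prop :=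
  forall (x : X) (e : R), 0 < e -> exists2 delta : R, 0 < delta &
    forall y : X, d x y < delta -> rho (f x) (f y) < e.

(* Main.v *)
(* If ff-continuity fails at x, choose u n with d x (u n) -> 0 while
   f (u n) stays away from f x.  The sequence u interleaved with the constant
   x still converges forward to x, hence also backward, hence is left
   K-Cauchy through x; left K-Cauchyness of its image compares f x with
   f (u n) for large n. *)
Require Import Defs.
From mathcomp Require Import all_boot all_order all_algebra.
From mathcomp Require Import boolp classical_sets reals topology normedtype.
From mathcomp Require Import sequences.
Import Order.TTheory GRing.Theory Num.Theory.
Import numFieldNormedType.Exports.

Set Implicit Arguments.
Unset Strict Implicit.
Unset Printing Implicit Defensive.

Local Open Scope classical_set_scope.
Local Open Scope ring_scope.

(** The triangle inequality through [x] bounds [d (u k) (u n)] by a backward term at [k] plus a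
    forward term at [n], each eventually below [e / 2]. *)
Lemma forward_backward_left_K_cauchy (R : realType) (X : Type)
    (d : X -> X -> R) (d_qm : is_quasimetric d) (u : nat -> X) (x : X) :
  forward_cvg d u x -> backward_cvg d u x -> left_K_cauchy d u.
Proof.
move=> /cvgrPdist_lt fu /cvgrPdist_lt bu e e0.
have e20 : 0 < e / 2 by rewrite divr_gt0.
have [N1 _ h1] := fu _ e20; have [N2 _ h2] := bu _ e20.
exists (maxn N1 N2) => k n; rewrite geq_max => /andP[N1k N2k] kn.
apply: le_lt_trans (qm_triangle d_qm _ _ x) _; rewrite [e]splitr.
have := h1 n (leq_trans N1k kn); have := h2 k N2k.
rewrite /= !sub0r !normrN !ger0_norm ?(qm_ge0 d_qm)//.
exact: ltrD.
Qed.

Lemma forward_cvg_lt_harmonic (R : realType) (X : Type)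
    (d : X -> X -> R) (d_qm : is_quasimetric d) (u : nat -> X) (x : X) :
  (forall n, d x (u n) < n.+1%:R^-1) -> forward_cvg d u x.
Proof.
move=> hu; apply: (squeeze_cvgr _ (cvg_cst 0) (@cvg_harmonic R)).
by apply: nearW => n; rewrite (qm_ge0 d_qm) ltW.
Qed.

Theorem theorem4p2 (R : realType) (X Y : Type)
  (d : X -> X -> R) (rho : Y -> Y -> R)
  (d_qm : is_quasimetric d) (rho_qm : is_quasimetric rho)
  (d_T1 : forward_T1 d) (d_fb : forward_implies_backward d)
  (f : X -> Y) (f_reg : left_K_cauchy_regular d rho f) :
  ff_continuous d rho f.
Proof.
move=> x e e0; apply: contrapT => nex.
have /choice[u hu] (n : nat) :
    exists y, d x y < n.+1%:R^-1 /\ e <= rho (f x) (f y).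
  apply: contrapT => ny; apply: nex; exists n.+1%:R^-1; first by rewrite invr_gt0.
  move=> y dy; rewrite ltNge; apply/negP => ey.
  by apply: ny; exists y.
(* Each [u n] that is kept stays at its own index, so the bound [n.+1%:R^-1] passes to [v]
   unchanged. *)
pose v n := if odd n then u n else x.
have fv : forward_cvg d v x.
  apply: (forward_cvg_lt_harmonic d_qm) => n; rewrite /v.
  by case: ifP => _; [case: (hu n)|rewrite (qm_refl d_qm) invr_gt0].
have [N hN] := f_reg _ (forward_backward_left_K_cauchy d_qm fv (d_fb _ _ fv)) _ e0.
have Nle : (N <= N.*2)%N by rewrite -addnn leq_addr.
(* An even index followed by an odd one: [x] comes first, so the bound is on [rho (f x) (f (u _))]
   and not on the reverse distance, which may differ. *)
have := hN N.*2 N.*2.+1 Nle (leqnSn _).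
rewrite /= /v /= odd_double /=.
by rewrite ltNge (hu _).2.
Qed.
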